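(* Every non-unimodular real Lie algebra $\mathfrak{g}$ of dimension $3$ admits an incomplete Lorentzian metric.
   Context: A real Lie algebra $\mathfrak{g}$ is unimodular if $\mathrm{tr}(\mathrm{ad}_x)=0$ for all $x\in\mathfrak{g}$, and non-unimodular otherwise. A Lorentzian metric on a 3-dimensional real Lie algebra $\mathfrak{g}$ is a non-degenerate symmetric bilinear form $q$ on $\mathfrak{g}$ of signature $(+,+,-)$. The geodesic field of $(\mathfrak{g},q)$ is the quadratic vector field $F$ on $\mathfrak{g}$ given by $F(v)=\mathrm{ad}^\dagger_v v$, where $\mathrm{ad}^\dagger_v$ is the $q$-transpose of $\mathrm{ad}_v$; that is, $q(F(v),w)=q(v,[v,w])$ for all $v,w\in\mathfrak{g}$. $(\mathfrak{g},q)$ (or simply $q$) is called (geodesically) complete if the left-invariant metric defined by $q$ on a Lie group $G$ with Lie algebra $\mathfrak{g}$ is geodesically complete; equivalently (Euler–Arnold), if the geodesic field is a complete vector field, i.e. all maximal solutions of $\dot v=F(v)$ are defined on all of $\mathbb{R}$. Otherwise $q$ is incomplete. *)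

(* Defs.v *)
From HB Require Import structures.
From mathcomp Require Import all_boot all_order all_algebra.
From mathcomp Require Import all_classical all_reals all_analysis.

Set Implicit Arguments.
Unset Strict Implicit.
Unset Printing Implicit Defensive.

Import Order.TTheory GRing.Theory Num.Theory.
Import numFieldNormedType.Exports.
Import passmx.

Local Open Scope classical_set_scope.
Local Open Scope ring_scope.

Section LieAlgebra.
Variables (K : fieldType) (g : vectType K) (br : {bilinear g -> g -> g}).

Definition lie_bracket :=
  (forall x, br x x = 0) /\
  (forall x y z, br x (br y z) + br y (br z x) + br z (br x y) = 0).

Definition ad (x : g) : 'End(g) := linfun (br x).

Definition endo_trace (f : 'End(g)) : K :=
  \tr (mxof (vbasis {:g}) (vbasis {:g}) f).

Definition unimodular := forall x, endo_trace (ad x) = 0.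

End LieAlgebra.

(* The q-transpose of f. The default value 0 is only used for degenerate q: see
   [qtransposeP]. *)
Definition qtranspose (K : fieldType) (V : vectType K) (q : {symmetric V})
    (f : 'End(V)) (v : V) : V :=
  xget 0 [set u : V | forall w, q u w = q v (f w)].

Definition geodesic_field (K : fieldType) (g : vectType K)
    (br : {bilinear g -> g -> g}) (q : {symmetric g}) (v : g) : g :=
  qtranspose q (ad br v) v.

Lemma nondegenerate_inj (K : fieldType) (V : vectType K) (q : {symmetric V}) :
  nondegenerate q -> forall u, (forall w, q u w = 0) -> u = 0.
Proof.
move=> /eqP nd u qu; apply/eqP; rewrite -memv0 -nd.
by apply/mem_orthovP => w _; exact: qu.
Qed.

Lemma nondegenerate_riesz (K : fieldType) (V : vectType K) (q : {symmetric V})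
    (f : {scalar V}) :
  nondegenerate q -> exists u, forall w, q u w = f w.
Proof.
move=> nd; pose e := vbasis {:V}; pose n := \dim {:V}.
have eB : basis_of {:V} e := vbasisP _.
pose G : 'M[K]_n := \matrix_(i < n, j < n) q e`_i e`_j.
have qG (a : 'rV_n) (j : 'I_n) : q (vecof e a) e`_j = (a *m G) 0 j.
  rewrite /vecof linear_sumlz mxE; apply: eq_bigr => i _.
  by rewrite linearZl_LR mxE.
have qE (u : V) (h : {scalar V}) :
    (forall j : 'I_n, q u e`_j = h e`_j) -> forall w, q u w = h w.
  move=> H w; rewrite (coord_vbasis (memvf w)) !linear_sum/=.
  apply: eq_bigr => j _.
  by rewrite linearZr_LR (linearZ_LR h) /= H.
have Gu : G \in unitmx.
  rewrite -row_free_unit; apply: inj_row_free => a aG0.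
  rewrite -(vecofK eB a); suff -> : vecof e a = 0 by rewrite linear0.
  apply: (nondegenerate_inj nd) => w.
  rewrite (coord_vbasis (memvf w)) linear_sum/= big1// => j _.
  by rewrite linearZr_LR /= qG aG0 mxE mulr0.
exists (vecof e ((\row_(j < n) f e`_j) *m invmx G)); apply: qE => j.
by rewrite qG mulmxKV// mxE.
Qed.

Lemma qtransposeP (K : fieldType) (V : vectType K) (q : {symmetric V})
    (f : 'End(V)) (v w : V) :
  nondegenerate q -> q (qtranspose q f v) w = q v (f w).
Proof.
move=> nd; rewrite /qtranspose; case: xgetP => [x _ xP|]; first exact: xP.
have lin : linear_for *%R (q v \o f).
  by move=> a x y /=; rewrite linearP linearDr linearZr_LR.
pose l : {scalar V} :=
  HB.pack (q v \o f : V -> K)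
    (GRing.isSemilinear.Build _ _ _ _ (q v \o f : V -> K) (GRing.semilinear_linear lin)).
have [u uP] := nondegenerate_riesz l nd.
by move=> /(_ u) []; exact: uP.
Qed.

(* Signature (+,+,-) is read off a q-orthogonal basis. *)
Definition lorentzian (R : realType) (g : vectType R) (q : {symmetric g}) : Prop :=
  nondegenerate q /\
  exists e1 e2 e3 : g,
    [/\ basis_of {:g} [:: e1; e2; e3],
        pairwise_orthogonal q [:: e1; e2; e3],
        0 < q e1 e1, 0 < q e2 e2 & q e3 e3 < 0].

Section VectorField.
Variables (R : realType) (V : vectType R).
Implicit Types (F : V -> V) (I : set R) (c : R -> V).

(* A [vectType] carries no topology; as V is finite-dimensional, curves are
   differentiated coordinatewise, and the choice of basis is immaterial. *)
Definition has_velocity c (t : R) (v : V) :=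
  forall i : 'I_(\dim {:V}),
    is_derive t 1 (fun s => coord (vbasis {:V}) i (c s))
                  (coord (vbasis {:V}) i v).

(* The values of c outside I are irrelevant. *)
Definition solution F I c :=
  [/\ I !=set0, open I, is_interval I &
      forall t, I t -> has_velocity c t (F (c t))].

Definition maximal_solution F I c :=
  solution F I c /\
  forall (J : set R) (d : R -> V), solution F J d -> I `<=` J ->
    (forall t, I t -> d t = c t) -> J = I.

Definition complete_field F :=
  forall I c, maximal_solution F I c -> I = setT.

End VectorField.

Definition geodesically_complete (R : realType) (g : vectType R)
    (br : {bilinear g -> g -> g}) (q : {symmetric g}) : Prop :=
  complete_field (geodesic_field br q).

(* Main.v *)
(* The linear form x |-> tr (ad x) vanishes on [g, g], and its kernel u is a
   2-dimensional ideal; being unimodular, u is abelian. Hence g = <x> + u where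
   A := ad x restricted to u has nonzero trace.
   If A has real eigenvalues, some eigenvalue l of A on a quotient u / <z>, with z
   an eigenvector, is nonzero; choosing q with x null and x^perp = <x, z> gives
   F(x) = l x, so that x / (1 - l t) is a geodesic.
   Otherwise A is a + bJ with J a rotation by a right angle and a != 0. Choosing q
   Euclidean on u and x timelike, the null geodesics v = s x + w satisfy
   |w|^2 = s^2 and s' = a s^2, while w / s rotates at speed b s; they blow up too. *)
From HB Require Import structures.
Require Import Defs.
From mathcomp Require Import all_boot all_order all_algebra.
From mathcomp Require Import all_classical all_reals all_analysis.
From mathcomp Require Import ring lra.

Set Implicit Arguments.
Unset Strict Implicit.
Unset Printing Implicit Defensive.

Import Order.TTheory GRing.Theory Num.Theory.
Import numFieldNormedType.Exports.
Import passmx.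

Local Open Scope ring_scope.

(** * Bases and coordinates in dimension three *)

Section Basis3.
Variables (K : fieldType) (V : vectType K).
Implicit Types u v w : V.

Lemma basis3P u v w : \dim {:V} = 3%N ->
  basis_of {:V} [:: u; v; w] <->
  (forall a b c : K, a *: u + b *: v + c *: w = 0 -> [/\ a = 0, b = 0 & c = 0]).
Proof.
move=> dimV.
have E (k : 'I_3 -> K) : \sum_(i < 3) k i *: [tuple u; v; w]`_i =
    k 0 *: u + k 1 *: v + k 2%:R *: w.
  rewrite !big_ord_recl big_ord0 /= addr0 addrA.
  by congr (_ + k _ *: _ + k _ *: _); apply/val_inj.
rewrite basisEfree subvf dimV /= andbT; split.
  move=> /(@freeP K V 3 [tuple u; v; w]) fr a b c abc.
  have /= H := fr (fun i : 'I_3 => [:: a; b; c]`_i).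
  rewrite E /= in H; have {}H := H abc.
  by split; [exact: (H 0)|exact: (H 1)|exact: (H 2%:R)].
move=> H; apply/(@freeP K V 3 [tuple u; v; w]) => k; rewrite E => /H[k0 k1 k2].
move=> [[|[|[|//]]] i3]; [apply: etrans k0|apply: etrans k1|apply: etrans k2];
  by congr k; apply/val_inj.
Qed.

(** The dual basis is delivered as abstract linear forms, from which the metrics are assembled
    below. *)
Lemma basis3_coord u v w : basis_of {:V} [:: u; v; w] ->
  exists x y z : {scalar V},
    [/\ forall t, t = x t *: u + y t *: v + z t *: w,
        [/\ x u = 1, x v = 0 & x w = 0],
        [/\ y u = 0, y v = 1 & y w = 0] &
        [/\ z u = 0, z v = 0 & z w = 1]].
Proof.
move=> uvw; pose e := [tuple u; v; w].
exists (coord e 0), (coord e 1), (coord e 2%:R).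
have cE (i j : 'I_3) : coord e j e`_i = (i == j)%:R.
  exact: coord_free (basis_free uvw).
split.
- move=> t; rewrite {1}(@coord_basis _ _ _ _ e t uvw (memvf _)).
  by rewrite !big_ord_recl big_ord0 /= addr0 addrA;
    congr (coord e _ _ *: _ + coord e _ _ *: _ + coord e _ _ *: _); apply/val_inj.
- by split; [exact: (cE 0 0)|exact: (cE 1 0)|exact: (cE 2%:R 0)].
- by split; [exact: (cE 0 1)|exact: (cE 1 1)|exact: (cE 2%:R 1)].
- by split; [exact: (cE 0 2%:R)|exact: (cE 1 2%:R)|exact: (cE 2%:R 2%:R)].
Qed.

End Basis3.

(** * The trace of an endomorphism and its independence of the basis *)

Section Trace.
Variables (K : fieldType) (g : vectType K).

Lemma endo_trace_is_linear : linear_for *%R (@endo_trace K g).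
Proof. by move=> a f h; rewrite /endo_trace linearP mxtraceD mxtraceZ. Qed.

HB.instance Definition _ := GRing.isSemilinear.Build _ _ _ _ (@endo_trace K g)
  (GRing.semilinear_linear endo_trace_is_linear).

Lemma endo_trace_comp (f h : 'End(g)) :
  endo_trace (f \o h)%VF = endo_trace (h \o f)%VF.
Proof. by rewrite /endo_trace !(mxof_comp _ _ (vbasisP _)) mxtrace_mulC. Qed.

(** Writing [f] as [f] composed with the identity, factored through [e], yields two change-of-basis
    matrices, which cyclicity of the trace recombines into the matrix of [f] in [e]. *)
Lemma endo_trace_coord n (e : n.-tuple g) (f : 'End(g)) :
  basis_of {:g} e -> endo_trace f = \sum_(i < n) coord e i (f e`_i).
Proof.
move=> eB; have En := size_basis eB; subst n.
have vB := vbasisP {:g}.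
rewrite /endo_trace -[f in LHS]comp_lfun1r (mxof_comp _ _ eB) mxtrace_mulC.
rewrite -(mxof_comp _ _ vB) comp_lfun1l; apply: eq_bigr => i _.
by rewrite !mxE /= vecof_delta.
Qed.

End Trace.

(** * The abelian ideal in a non-unimodular algebra *)

Section Structure.
Variables (K : fieldType) (g : vectType K) (br : {bilinear g -> g -> g}).
Hypothesis lie_br : lie_bracket br.

Lemma brC x y : br x y = - br y x.
Proof.
apply/eqP; rewrite -addr_eq0; have := lie_br.1 (x + y).
by rewrite linearDl /= !linearDr /= !lie_br.1 addr0 add0r => /eqP; rewrite addrC.
Qed.

Lemma adE x y : ad br x y = br x y.
Proof. by rewrite lfunE. Qed.

Lemma ad_is_linear : linear (ad br).
Proof.
move=> a x y; apply/lfunP => z.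
by rewrite add_lfunE scale_lfunE !adE linearDl /= linearZl_LR.
Qed.

HB.instance Definition _ := GRing.isSemilinear.Build _ _ _ _ (ad br)
  (GRing.semilinear_linear ad_is_linear).

(** The Jacobi identity in commutator form, so that the trace kills [ad] of every bracket. *)
Lemma ad_br x y : ad br (br x y) = (ad br x \o ad br y)%VF - (ad br y \o ad br x)%VF.
Proof.
apply/lfunP => z; rewrite add_lfunE opp_lfunE !comp_lfunE !adE.
have := lie_br.2 x y z.
by rewrite (brC z x) (brC z (br x y)) linearNr /= => /eqP; rewrite subr_eq0 => /eqP.
Qed.

Lemma trace_ad_br x y : endo_trace (ad br (br x y)) = 0.
Proof. by rewrite ad_br linearB /= endo_trace_comp subrr. Qed.

(** Here [y] and [z] span the kernel of the trace form [T], which contains all brackets, and [x] is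
    any vector with nonzero [T x]; the sum [a + d] equals [T x]. *)
Lemma nonunimodular_normal_form : \dim {:g} = 3%N -> ~ unimodular br ->
  exists x y z, basis_of {:g} [:: x; y; z] /\ br y z = 0 /\
  exists a b c d, [/\ br x y = a *: y + b *: z, br x z = c *: y + d *: z & a + d != 0].
Proof.
move=> dimg /existsNP[x /eqP tx0].
pose T := linfun (@endo_trace K g \o ad br : g -> K^o).
have TE v : T v = endo_trace (ad br v) by rewrite lfunE.
have [y [z yzB]] : exists y z, basis_of (lker T) [:: y; z].
  (* [T] is a nonzero form, hence of rank one, and rank-nullity leaves a kernel of dimension two. *)
  have d1 : \dim (limg T) = 1%N.
    apply/eqP; rewrite eqn_leq; apply/andP; split.
      by rewrite (leq_trans (dimvS (subvf _)))// dimvf.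
    rewrite lt0n dimv_eq0; apply: contra tx0 => /eqP T0.
    by have := memv_img T (memvf x); rewrite T0 memv0 TE.
  have := limg_ker_dim T {:g}; rewrite capfv d1 dimg addn1 => -[d2].
  have := vbasisP (lker T); case: (vbasis _) => -[|y [|z [|? ?]]] //=;
    rewrite d2 // => _ yzB.
  by exists y, z.
have mem2 v : endo_trace (ad br v) = 0 -> exists a b, v = a *: y + b *: z.
  move=> v0; have vK : v \in lker T by rewrite memv_ker TE v0.
  rewrite (@coord_basis _ _ _ _ [tuple y; z] v yzB vK) !big_ord_recl big_ord0 addr0 /=.
  by eexists; eexists.
have [Ty Tz] : T y = 0 /\ T z = 0.
  split; apply/eqP; rewrite -memv_ker; apply: (basis_mem yzB);
  by rewrite !inE eqxx ?orbT.
have xyzB : basis_of {:g} [:: x; y; z].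
  apply/basis3P => // a b c abc.
  have a0 : a = 0.
    move/(congr1 T): (abc).
    rewrite !linearD !linearZ /= Ty Tz !scaler0 !addr0 linear0 TE => H.
    have /eqP : a * endo_trace (ad br x) = 0 by exact: H.
    by rewrite mulf_eq0 (negPf tx0) orbF => /eqP.
  have {}abc : b *: y + c *: z = 0 by move: abc; rewrite a0 scale0r add0r.
  have /= fr := elimT (@freeP K g 2 [tuple y; z]) (basis_free yzB)
    (fun i : 'I_2 => [:: b; c]`_i).
  rewrite !big_ord_recl big_ord0 addr0 /= in fr.
  by have {}fr := fr abc; split=> //; [exact: (fr 0)|exact: (fr 1)].
exists x, y, z; split=> //.
have [a [b xyE]] := mem2 _ (trace_ad_br x y).
have [c [d xzE]] := mem2 _ (trace_ad_br x z).
have [p [q yzE]] := mem2 _ (trace_ad_br y z).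
have [X [Y [Z [tE [Xx Xy Xz] [Yx Yy Yz] [Zx Zy Zz]]]]] := basis3_coord xyzB.
have trE u : endo_trace (ad br u) = X (br u x) + Y (br u y) + Z (br u z).
  rewrite (@endo_trace_coord _ _ _ [tuple x; y; z]) //.
  have cE (i : 'I_3) t : coord [tuple x; y; z] i t = [:: X t; Y t; Z t]`_i.
    rewrite {1}(tE t) !linearD !linearZ /=.
    have xyzF := basis_free xyzB.
    rewrite (coord_free 0 i (xyzF : free [tuple x; y; z])).
    rewrite (coord_free 1 i (xyzF : free [tuple x; y; z])).
    rewrite (coord_free 2%:R i (xyzF : free [tuple x; y; z])).
    by case: i => [[|[|[|//]]] i3]; rewrite /= ?(mulr1, mulr0, addr0, add0r).
  by rewrite !big_ord_recl big_ord0 addr0 addrA /= !adE !cE.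
(* In the basis [x], [y], [z] the trace of [ad y] is [q] and that of [ad z] is [- p]; both vanish
   because [y] and [z] lie in the kernel of [T]. *)
have q0 : q = 0.
  move: (trE y); rewrite lie_br.1 (brC y x) xyE yzE -[LHS]TE Ty.
  rewrite !linearN !linearD !linearZ /= Xy Xz Zy Zz linear0.
  by rewrite !mulr0 mulr1 !addr0 oppr0 !add0r => <-.
have p0 : p = 0.
  move: (trE z); rewrite lie_br.1 (brC z x) (brC z y) xzE yzE -[LHS]TE Tz.
  rewrite !linearN !linearD !linearZ /= Xy Xz Yy Yz linear0.
  by rewrite !mulr0 mulr1 !addr0 oppr0 !add0r => /esym/eqP; rewrite oppr_eq0 => /eqP.
split; first by rewrite yzE p0 q0 !scale0r addr0.
exists a, b, c, d; split=> //.
move: tx0; rewrite trE lie_br.1 xyE xzE linear0 add0r.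
by rewrite !linearD !linearZ /= Yy Yz Zy Zz !mulr0 !mulr1 addr0 add0r.
Qed.

End Structure.

(** * Normal forms of [ad x] on the abelian ideal *)

Lemma lincomb2 (K : fieldType) (V : lmodType K) (y z : V)
    (a b p q r s : K) :
  a *: (p *: y + q *: z) + b *: (r *: y + s *: z) =
  (a * p + b * r) *: y + (a * q + b * s) *: z.
Proof. by rewrite !scalerDr !scalerA addrACA -!scalerDl. Qed.

Lemma basis3_change (K : fieldType) (V : vectType K) (x y z : V) (p q r s : K) :
  \dim {:V} = 3%N -> basis_of {:V} [:: x; y; z] -> p * s - q * r != 0 ->
  basis_of {:V} [:: x; p *: y + q *: z; r *: y + s *: z].
Proof.
move=> dimV /(basis3P _ _ _ dimV) fr det0; apply/basis3P => // a b c.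
rewrite -addrA lincomb2 addrA => /fr[a0 h1 h2].
(* Cramer's rule: the determinant times [b] or [c] is a combination of the two vanishing
   coefficients [h1] and [h2]. *)
have hb : b * (p * s - q * r) = (b * p + c * r) * s - (b * q + c * s) * r by ring.
have hc : c * (p * s - q * r) = (b * q + c * s) * p - (b * p + c * r) * q by ring.
rewrite h1 h2 !mul0r subrr in hb hc.
by split=> //; apply/eqP; [move/eqP: hb|move/eqP: hc];
  rewrite mulf_eq0 (negPf det0) orbF.
Qed.

Section NormalForms.
Variables (R : rcfType) (g : vectType R) (br : {bilinear g -> g -> g}).
Hypothesis dim_g : \dim {:g} = 3%N.

(** A triangular form: [z] is an eigenvector and [l] is the eigenvalue on the quotient by [z]. *)
Definition real_form x y z := exists l k m,
  [/\ l != 0, br x y = l *: y + k *: z & br x z = m *: z].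

(** Under [y] = 1 and [z] = i, [ad x] is multiplication by the complex number a + ib. *)
Definition complex_form x y z := exists a b,
  [/\ a != 0, br x y = a *: y + b *: z & br x z = - b *: y + a *: z].

Lemma brDZ x y z p q : br x (p *: y + q *: z) = p *: br x y + q *: br x z.
Proof. by rewrite linearDr /= !linearZr_LR. Qed.

(* For b != 0, ad x has a companion matrix in the basis (y, [x, y]), so its type
   is read off the sign of the discriminant. *)
Lemma solvable_normal_form x y z a b c d :
  basis_of {:g} [:: x; y; z] -> br x y = a *: y + b *: z ->
  br x z = c *: y + d *: z -> a + d != 0 -> br y z = 0 -> lie_bracket br ->
  exists y' z', [/\ basis_of {:g} [:: x; y'; z'], br y' z' = 0 &
    real_form x y' z' \/ complex_form x y' z'].
Proof.
move=> xyzB xy xz tr0 yz0 lie.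
suff [p [q [r [s [det0 H]]]]] : exists p q r s, p * s - q * r != 0 /\
    (real_form x (p *: y + q *: z) (r *: y + s *: z) \/
     complex_form x (p *: y + q *: z) (r *: y + s *: z)).
  exists (p *: y + q *: z), (r *: y + s *: z); split=> //.
    exact: basis3_change.
  rewrite linearDl /= !linearZl_LR /= !brDZ (brC lie z y) yz0 !lie.1.
  by rewrite !(scaler0, addr0, oppr0).
have brE p q : br x (p *: y + q *: z) = (p * a + q * c) *: y + (p * b + q * d) *: z.
  by rewrite brDZ xy xz lincomb2.
have [b0|b0] := eqVneq b 0.
  have [d0|d0] := eqVneq d 0.
    have a0 : a != 0 by move: tr0; rewrite d0 addr0.
    (* Correcting [z] by a multiple of [y] gives a vector killed by [ad x]; the quotient eigenvalue
       is then [a]. *)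
    exists 1, 0, (- c / a), 1; split; first by rewrite mul0r subr0 mulr1 oner_eq0.
    left; exists a, 0, 0; split=> //; rewrite brE ?lincomb2.
      by congr (_ *: _ + _ *: _); rewrite ?b0; ring.
    rewrite scale0r b0 d0 !mulr0 addr0 scale0r addr0 divfK // mul1r addNr.
    by rewrite scale0r.
  (* Here [y] is the eigenvector and [d] the quotient eigenvalue, so the two vectors trade
     places. *)
  exists 0, 1, 1, 0; split; first by rewrite mul0r sub0r mulr1 oppr_eq0 oner_eq0.
  left; exists d, c, a; split=> //; rewrite brE ?lincomb2.
    by congr (_ *: _ + _ *: _); ring.
  by rewrite scalerDr !scalerA; congr (_ *: _ + _ *: _); rewrite ?b0; ring.
pose D := (a + d) ^+ 2 - 4%:R * (a * d - b * c).
have [D0|D0] := leP 0 D.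
  (* The roots of the characteristic polynomial sum to [a + d], so one of them is nonzero. *)
  have [l [l0 lr]] : exists l, l != 0 /\ l ^+ 2 - (a + d) * l + (a * d - b * c) = 0.
    have sD : Num.sqrt D ^+ 2 = D by rewrite sqr_sqrtr.
    have root e : e ^+ 2 = D -> ((a + d + e) / 2%:R) ^+ 2
        - (a + d) * ((a + d + e) / 2%:R) + (a * d - b * c) = 0.
      move=> eD; have -> : a * d - b * c = ((a + d) ^+ 2 - e ^+ 2) / 4%:R.
        by rewrite eD /D; field.
      by field.
    have [l0|l0] := eqVneq ((a + d + Num.sqrt D) / 2%:R) 0; last first.
      by exists ((a + d + Num.sqrt D) / 2%:R); split; [|exact: root].
    exists ((a + d - Num.sqrt D) / 2%:R); split; last first.
      by apply: root; rewrite sqrrN.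
    apply: contra tr0 => /eqP l0'.
    have -> : a + d = (a + d + Num.sqrt D) / 2%:R + (a + d - Num.sqrt D) / 2%:R by field.
    by rewrite l0 l0' addr0.
  (* The new [z] is [[x, y] - l y], by Cayley-Hamilton an eigenvector for the other root
     [a + d - l]. *)
  exists 1, 0, (a - l), b; split; first by rewrite mul0r subr0 mul1r.
  left; exists l, 1, (a + d - l); split=> //; rewrite brE ?lincomb2.
    by congr (_ *: _ + _ *: _); ring.
  rewrite scalerDr !scalerA; congr (_ *: _ + _ *: _); last by ring.
  by apply/eqP; rewrite -subr_eq0; apply/eqP; rewrite -[RHS]oppr0 -[in RHS]lr; ring.
pose e := Num.sqrt (- D) / 2%:R.
have sD : Num.sqrt (- D) ^+ 2 = - D by rewrite sqr_sqrtr // oppr_ge0 ltW.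
have e2 : e ^+ 2 = - D / 4%:R by rewrite /e expr_div_n sD; field.
have e0 : e != 0.
  by rewrite -sqrf_eq0 e2 mulf_neq0 // ?oppr_eq0 ?ltr0_neq0 // invr_eq0 pnatr_eq0.
pose h := (a + d) / 2%:R.
have h0 : h != 0 by rewrite mulf_neq0 // invr_eq0 pnatr_eq0.
(* The eigenvalues are h + ie and h - ie, so [ad x - h] squares to minus [e ^+ 2]; the new [z] is
   its value at [y] divided by [e]. *)
exists 1, 0, ((a - h) / e), (b / e); split.
  by rewrite mul0r subr0 mul1r mulf_neq0 // invr_eq0.
right; exists h, e; split=> //; rewrite brE lincomb2.
  by congr (_ *: _ + _ *: _); field.
congr (_ *: _ + _ *: _); last by rewrite /h; field.
apply: (mulfI e0); rewrite !mulrDr.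
have -> : e * (- e * 1) = - e ^+ 2 by ring.
by rewrite e2 /D /h; field.
Qed.

End NormalForms.

(** * Lorentzian forms built from coordinates, and evaluation of the geodesic field *)

Section Minkowski.
Variables (R : realType) (V : vectType R) (x y z : {scalar V}).

Definition minkowski (u v : V) : R := x u * x v + y u * y v - z u * z v.

Lemma minkowski_bilinear :
  bilinear_for (GRing.Scale.Law.clone _ _ *%R _)
    (GRing.Scale.Law.clone _ _ (@idfun R \; *%R) _) minkowski.
Proof.
by split=> u a v w; rewrite /minkowski !linearP /=; ring.
Qed.

HB.instance Definition _ := bilinear_isBilinear.Build R V V R _ _ minkowski
  minkowski_bilinear.

(** Symmetry in the shape of a Hermitian form with trivial sign and trivial conjugation. *)
Lemma minkowski_sym u v : minkowski u v = (-1) ^+ false * idfun (minkowski v u).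
Proof. by rewrite /minkowski /=; ring. Qed.

HB.instance Definition _ := isHermitianSesquilinear.Build R V false idfun minkowski
  minkowski_sym.

Definition minkowski_form : {symmetric V} := minkowski.

Lemma minkowski_formE u v : minkowski_form u v = x u * x v + y u * y v - z u * z v.
Proof. by []. Qed.

Lemma minkowski_lorentzian e1 e2 e3 : basis_of {:V} [:: e1; e2; e3] ->
  [/\ x e1 = 1, x e2 = 0 & x e3 = 0] -> [/\ y e1 = 0, y e2 = 1 & y e3 = 0] ->
  [/\ z e1 = 0, z e2 = 0 & z e3 = 1] ->
  (forall v, v = x v *: e1 + y v *: e2 + z v *: e3) -> lorentzian minkowski_form.
Proof.
move=> eB [x1 x2 x3] [y1 y2 y3] [z1 z2 z3] vE.
split.
  rewrite /nondegenerate -subv0; apply/subvP => u /mem_orthovP H.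
  have := H _ (memvf e1); have := H _ (memvf e2); have := H _ (memvf e3).
  rewrite !minkowski_formE x1 x2 x3 y1 y2 y3 z1 z2 z3 !mulr0 !mulr1 !subr0 !addr0 !add0r.
  by move=> /eqP; rewrite oppr_eq0 => /eqP zu yu xu;
    rewrite (vE u) xu yu zu !scale0r !addr0 mem0v.
exists e1, e2, e3; rewrite !minkowski_formE x1 x2 x3 y1 y2 y3 z1 z2 z3.
split=> //; try lra.
rewrite /pairwise_orthogonal /= !minkowski_formE x1 x2 x3 y1 y2 y3 z1 z2 z3.
rewrite !(mulr0, mul0r, addr0, subr0, eqxx) /= andbT.
by apply/negP => /(basis_not0 eB); rewrite eqxx.
Qed.

End Minkowski.

(** Reduces the computation of the field to checking a guessed value against every [w];
    nondegeneracy makes that value unique. *)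
Lemma geodesic_fieldE (K : fieldType) (g : vectType K) (br : {bilinear g -> g -> g})
    (q : {symmetric g}) (u v : g) : nondegenerate q ->
  (forall w, q u w = q v (br v w)) -> geodesic_field br q v = u.
Proof.
move=> nd H; apply/eqP; rewrite -subr_eq0; apply/eqP.
apply: (nondegenerate_inj nd) => w.
by rewrite linearBl /= qtransposeP // H lfunE subrr.
Qed.

(** * Incompleteness from a coordinate with a pole *)

Section Blowup.
Variables (R : realType) (V : vectType R).
Local Open Scope classical_set_scope.

(** A linear form is a fixed linear combination of the coordinates that define the velocity. *)
Lemma has_velocity_scalar (c : R -> V) t v (f : {scalar V}) :
  has_velocity c t v -> is_derive t 1 (fun s => f (c s)) (f v).
Proof.
move=> cv.
have E : (fun s => f (c s)) =
    \sum_(i < \dim {:V}) (f (vbasis {:V})`_i \*: (fun s => coord (vbasis {:V}) i (c s))).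
  apply/funext => s; rewrite fct_sumE {1}(coord_vbasis (memvf (c s))) linear_sum.
  by apply: eq_bigr => i _; rewrite linearZ /= mulrC.
rewrite E [in X in is_derive _ _ _ X](coord_vbasis (memvf v)) linear_sum.
apply: is_derive_eq.
  by apply: is_derive_sum => i; apply: is_deriveZ; exact: cv.
by apply: eq_bigr => i _; rewrite linearZ /= mulrC.
Qed.

(** The curve is a maximal solution on the half-line [I] bounded by the pole [l^-1]: along an
    extension past the pole, [f] would be continuous there and yet unbounded. *)
Lemma blowup_incomplete (F : V -> V) (c : R -> V) (f : {scalar V}) (l : R) : l != 0 ->
  (forall t : R, 0 < 1 - l * t -> has_velocity c t (F (c t))) ->
  (forall t : R, 0 < 1 - l * t -> f (c t) = (1 - l * t)^-1) ->
  ~ complete_field F.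
Proof.
move=> l0 cF fc; pose I := [set t : R | 0 < 1 - l * t].
move=> /(_ I c) complete; suff /complete IT : maximal_solution F I c.
  have : I l^-1 by rewrite IT.
  by rewrite /I /= divff // subrr ltxx.
have I0 : I 0 by rewrite /I /= mulr0 subr0.
split.
  split=> //; first by exists 0.
  - have -> : I = (fun t => 1 - l * t) @^-1` [set x | 0 < x] by [].
    apply: open_comp; last exact: open_gt.
    by move=> t _; apply: cvgB; [exact: cvg_cst|apply: cvgM; [exact: cvg_cst|exact: cvg_id]].
  - move=> a b /= Ia Ib t /andP[at_ tb]; rewrite /I /=.
    have [lp|ln] := ltP 0 l; first by apply: lt_le_trans Ib _; rewrite lerB // ler_pM2l.
    by apply: lt_le_trans Ia _; rewrite lerB // ler_wnM2l.
move=> J d [_ _ Jitv Jd] IJ dc; apply/seteqP; split=> // t Jt.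
rewrite /I /= ltNge; apply/negP; rewrite subr_le0 => tI.
(* The pole lies between 0 and [t], both in the interval [J]; the order depends on the sign of
   [l]. *)
have Jl : J l^-1.
  have [lp|ln] := ltP 0 l.
    apply: (Jitv 0 t) => //; first exact: IJ.
    by rewrite invr_ge0 ltW //= -div1r ler_pdivrMr // mulrC.
  have {}ln : l < 0 by rewrite lt_neqAle l0.
  apply: (Jitv t 0) => //; first exact: IJ.
  by rewrite invr_le0 (ltW ln) andbT -div1r ler_ndivlMr // mulrC.
(* With [e] standing for [1 - l * s], positive [e] approaches the pole from inside [I] for either
   sign of [l]. Continuity of [f] along [d] gives [k] the limit 0, whereas the explicit formula
   makes it constantly 1. *)
pose k (e : R) := f (d (l^-1 - e / l)) * e.
have k0 : k e @[e --> 0^'+] --> (0 : R).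
  apply: cvg_at_right_filter.
  rewrite -[X in _ --> X](mulr0 (f (d l^-1))).
  apply: cvgM; last exact: cvg_id.
  have fd : f (d s) @[s --> l^-1] --> f (d l^-1).
    apply: differentiable_continuous; apply/derivable1_diffP.
    by have [] := has_velocity_scalar f (Jd _ Jl).
  have : (l^-1 - e / l) @[e --> (0 : R)] --> l^-1 - 0 / l.
    by apply: cvgB; [exact: cvg_cst|apply: cvgM; [exact: cvg_id|exact: cvg_cst]].
  rewrite mul0r subr0 => H; exact: (cvg_comp _ _ H fd).
have k1 : k e @[e --> 0^'+] --> (1 : R).
  apply: cvg_near_cst; near=> e.
  have e0 : 0 < e by near: e; exact: nbhs_right_gt.
  have E : 1 - l * (l^-1 - e / l) = e by field.
  have Ie : I (l^-1 - e / l) by rewrite /I /= E.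
  by rewrite /k dc // fc // E mulVf // gt_eqF.
have /eqP : 1 = 0 :> R by exact: (cvg_unique _ k1 k0).
by rewrite oner_eq0.
Unshelve. all: by end_near. Qed.

End Blowup.

(** * Derivatives of the explicit geodesics *)

Section Curves.
Variables (R : realType).

Lemma is_derive_affine (l t : R) : is_derive t 1 (fun s => 1 - l * s) (- l).
Proof.
have d : is_derive t 1 (cst 1 - l \*: (@id R)) (0 - l *: 1) by exact: is_deriveB.
by apply: is_derive_eq d _; rewrite sub0r /GRing.scale /= mulr1.
Qed.

(** This is the model equation s' = l s^2 governing both blow-ups. *)
Lemma is_derive_pole (l t : R) : 0 < 1 - l * t ->
  is_derive t 1 (fun s => (1 - l * s)^-1) (l * (1 - l * t)^-1 ^+ 2).
Proof.
move=> lt.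
have d := is_derive_affine l t.
have n0 : 1 - l * t != 0 by rewrite gt_eqF.
apply: DeriveDef; first exact: derivableV.
by rewrite deriveV // derive_val /GRing.scale /= exprVn; ring.
Qed.

Lemma is_derive_log_pole (l k t : R) : 0 < 1 - l * t ->
  is_derive t 1 (fun s => k * ln (1 - l * s)) (- (k * l) * (1 - l * t)^-1).
Proof.
move=> lt.
have d := is_derive_affine l t.
have dl := @is_derive1_comp _ _ (fun s => 1 - l * s) _ _ _ (is_derive1_ln lt) d.
by apply: (is_derive_eq (is_deriveZ k dl)); rewrite /GRing.scale /=; ring.
Qed.

Lemma has_velocity_lincomb3 (V : vectType R) (x y z : V) (a b c : R -> R) (t a' b' c' : R) :
  is_derive t 1 a a' -> is_derive t 1 b b' -> is_derive t 1 c c' ->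
  has_velocity (fun s => a s *: x + b s *: y + c s *: z) t
    (a' *: x + b' *: y + c' *: z).
Proof.
move=> da db dc i; pose C : {scalar V} := coord (vbasis {:V}) i.
rewrite -/(C _); under eq_fun do rewrite -/(C _).
have -> : (fun s => C (a s *: x + b s *: y + c s *: z)) =
    (C x \*: a) + (C y \*: b) + (C z \*: c).
  by apply/funext => s; rewrite !linearD !linearZ /= !fctE /=; congr (_ + _ + _);
    rewrite mulrC.
apply: is_derive_eq.
by rewrite !linearD !linearZ /= /GRing.scale /=; ring.
Qed.

End Curves.

(** * Incomplete metrics for the two normal forms *)

Section Incomplete.
Variables (R : realType) (g : vectType R) (br : {bilinear g -> g -> g}).
Hypotheses (dim_g : \dim {:g} = 3%N) (lie_br : lie_bracket br).

(* Unlike [linearD] and [linearZ], these do not match multiplication in R. *)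
Let scalarD (f : {scalar g}) u v : f (u + v) = f u + f v.
Proof. exact: linearD. Qed.
Let scalarZ (f : {scalar g}) a v : f (a *: v) = a * f v.
Proof. exact: linearZ. Qed.

(** In the metric chosen, [x] and [y] are null with product 1 and [z] is a unit vector orthogonal to
    both. So [q x [x, w]] is [l] times the [y]-coordinate of [w], which is [q (l x) w]. *)
Lemma real_form_incomplete x y z : basis_of {:g} [:: x; y; z] ->
  real_form br x y z -> exists q, lorentzian q /\ ~ geodesically_complete br q.
Proof.
move=> xyzB [l [k [m [l0 xy xz]]]].
(* An orthonormal pair, [e1] spacelike and [e3] timelike, for which [x] and [y = e1 - e3] are
   null. *)
pose e1 := x + 2^-1 *: y; pose e3 := x + (- 2^-1) *: y.
have eB : basis_of {:g} [:: e1; z; e3].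
  apply/basis3P => // a b c abc.
  have /(basis3P _ _ _ dim_g)/(_ (a + c) ((a - c) / 2) b) := xyzB.
  case; last by move=> h1 h2 h3; split=> //; lra.
  rewrite -[RHS]abc [RHS]addrAC; congr (_ + _).
  rewrite /e1 /e3 !scalerDr !scalerA addrACA -!scalerDl.
  by congr (_ + _ *: _); field.
have [X [Y [Z [vE [X1 X2 X3] [Y1 Y2 Y3] [Z1 Z2 Z3]]]]] := basis3_coord eB.
have lq := minkowski_lorentzian eB (And3 X1 X2 X3) (And3 Y1 Y2 Y3) (And3 Z1 Z2 Z3) vE.
exists (minkowski_form X Y Z); split=> //.
rewrite /e1 /e3 !linearD !linearZ /= in X1 X3 Y1 Y3 Z1 Z3.
have solve (p q r s : R) : p + 2^-1 * q = r -> p + - 2^-1 * q = s ->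
    p = (r + s) / 2 /\ q = r - s by move=> h1 h2; split; lra.
have [Xx Xy] := solve _ _ _ _ X1 X3.
have [Yx Yy] := solve _ _ _ _ Y1 Y3.
have [Zx Zy] := solve _ _ _ _ Z1 Z3.
have [T [_ [_ [_ [Tx _ _] _ _]]]] := basis3_coord xyzB.
(* The zero terms only give the curve the shape expected by [has_velocity_lincomb3]. *)
pose c t := (1 - l * t)^-1 *: x + (0 : R) *: x + (0 : R) *: x.
apply: (@blowup_incomplete _ _ _ c T l) => // t tl; last first.
  by rewrite /c !linearD !linearZ /= Tx mulr1 !mul0r !addr0.
have -> : geodesic_field br (minkowski_form X Y Z) (c t) =
    (l * (1 - l * t)^-1 ^+ 2) *: x + 0 *: x + 0 *: x.
  apply: geodesic_fieldE => [|w]; first exact: lq.1.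
  have brw : br (c t) w = (1 - l * t)^-1 *: (X w *: (2^-1 *: (l *: y + k *: z))
      + Y w *: (m *: z) + Z w *: (- 2^-1 *: (l *: y + k *: z))).
    rewrite /c !scale0r !addr0 linearZl_LR /= [in LHS](vE w) /e1 /e3.
    by rewrite !(linearDr, linearZr_LR) /= lie_br.1 !add0r xy xz.
  rewrite brw /c !scale0r !addr0.
  rewrite !minkowski_formE !(scalarD, scalarZ).
  rewrite Xx Xy X2 Yx Yy Y2 Zx Zy Z2.
  by field; rewrite gt_eqF.
by apply: has_velocity_lincomb3; exact: is_derive_pole.
Qed.

(** On the Euclidean plane of [y] and [z] the field is [s] times the transpose of [ad x]; the
    [x]-component is positive relative to [a] because [x] is timelike. *)
Lemma complex_form_field x y z a b (X Y Z : {scalar g}) (s p r : R) :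
  br x y = a *: y + b *: z -> br x z = - b *: y + a *: z -> br y z = 0 ->
  lorentzian (minkowski_form Y Z X) ->
  (forall v, v = Y v *: y + Z v *: z + X v *: x) ->
  [/\ Y y = 1, Y z = 0 & Y x = 0] -> [/\ Z y = 0, Z z = 1 & Z x = 0] ->
  [/\ X y = 0, X z = 0 & X x = 1] ->
  geodesic_field br (minkowski_form Y Z X) (s *: x + p *: y + r *: z) =
  (a * (p ^+ 2 + r ^+ 2)) *: x + (s * (a * p + b * r)) *: y
    + (s * (a * r - b * p)) *: z.
Proof.
move=> xy xz yz [nd _] vE [Yy Yz Yx] [Zy Zz Zx] [Xy Xz Xx].
apply: geodesic_fieldE => // w; rewrite [in br _ w](vE w).
(* As [y] and [z] commute, only brackets with [x] survive. *)
have -> : br (s *: x + p *: y + r *: z) (Y w *: y + Z w *: z + X w *: x) =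
    (s * Y w - X w * p) *: (a *: y + b *: z)
    + (s * Z w - X w * r) *: (- b *: y + a *: z).
  rewrite !(linearDl, linearZl_LR) /= !(linearDr, linearZr_LR) /=.
  rewrite (brC lie_br y x) (brC lie_br z x) (brC lie_br z y) !lie_br.1 yz -xy -xz.
  rewrite !(oppr0, scaler0, addr0, add0r) !scalerN !scalerA.
  by rewrite scalerDr !scalerA !scalerBl ![X w * _]mulrC [RHS]addrACA addrA.
rewrite !minkowski_formE !(scalarD, scalarZ) Yy Yz Yx Zy Zz Zx Xy Xz Xx.
by ring.
Qed.

Lemma complex_form_incomplete x y z : basis_of {:g} [:: x; y; z] -> br y z = 0 ->
  complex_form br x y z -> exists q, lorentzian q /\ ~ geodesically_complete br q.
Proof.
move=> xyzB yz [a [b [a0 xy xz]]].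
have eB : basis_of {:g} [:: y; z; x].
  have /perm_basis -> // : perm_eq [:: y; z; x] [:: x; y; z].
  by rewrite (perm_rcons x [:: y; z]).
have [Y [Z [X [vE HY HZ HX]]]] := basis3_coord eB.
have lq := minkowski_lorentzian eB HY HZ HX vE.
exists (minkowski_form Y Z X); split=> //.
(* The angle [th] is the primitive of [b * s] vanishing at 0. *)
pose s t := (1 - a * t)^-1; pose th t := - (b / a) * ln (1 - a * t).
(* The minus sign reflects that the transpose of [ad x] rotates in the opposite direction. *)
pose c t := s t *: x + (s t * cos (th t)) *: y + (- (s t * sin (th t))) *: z.
apply: (@blowup_incomplete _ _ _ c X a) => // t ta; last first.
  case: HX => Xy Xz Xx; rewrite /c !(scalarD, scalarZ) Xy Xz Xx.
  by rewrite !mulr0 !addr0 mulr1.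
rewrite (complex_form_field _ _ _ xy xz yz lq vE HY HZ HX).
have ds := is_derive_pole ta; have dth := is_derive_log_pole (- (b / a)) ta.
have dcos := @is_derive1_comp _ _ th _ _ _ (is_derive_cos (th t)) dth.
have dsin := @is_derive1_comp _ _ th _ _ _ (is_derive_sin (th t)) dth.
have n0 : 1 - a * t != 0 by rewrite gt_eqF.
apply: has_velocity_lincomb3.
(* The curve is null: the squares of its [y] and [z] components add up to the square of [s]. *)
- apply: (is_derive_eq ds).
  by rewrite sqrrN !exprMn -mulrDr cos2Dsin2 mulr1.
- apply: (is_derive_eq (is_deriveM ds dcos)).
  by rewrite /GRing.scale /= -/(s t) -/(th t); field.
- apply: (is_derive_eq (is_deriveN (is_deriveM ds dsin))).
  by rewrite /GRing.scale /= -/(s t) -/(th t); field.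
Qed.

End Incomplete.

Theorem theorem1p3 (R : realType) (g : vectType R)
    (br : {bilinear g -> g -> g}) (dim_g : \dim {:g} = 3%N)
    (lie_br : lie_bracket br) (nonuni : ~ unimodular br) :
  exists q : {symmetric g}, lorentzian q /\ ~ geodesically_complete br q.
Proof.
have [x [y [z [xyzB [yz0 [a [b [c [d [xy xz tr0]]]]]]]]]] :=
  nonunimodular_normal_form lie_br dim_g nonuni.
have [y' [z' [xyzB' yz0' [H|H]]]] :=
  solvable_normal_form dim_g xyzB xy xz tr0 yz0 lie_br.
  exact: real_form_incomplete H.
exact: complex_form_incomplete H.
Qed.
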